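(* Let $\alpha>0$, $t_0>0$, $x_0\in\mathcal H$, and let $x:[t_0,+\infty)\to\mathcal H$ be a solution of the Cauchy problem $$\tfrac{\alpha}{t}\dot x(t)+\operatorname{proj}_{C(x(t))+\ddot x(t)}(0)=0\ (t>t_0),\qquad x(t_0)=x_0,\ \dot x(t_0)=0 .$$ Assume that every $f_i$ is bounded from below and that the Assumption on the weak Pareto set in the context holds. Then for every $i=1,\dots,m$ the limit $f_i^\infty=\lim_{t\to\infty}f_i(x(t))$ exists in $\mathbb R$, and $f_i^\infty=\mathcal W_i^\infty$, where $\mathcal W_i^\infty=\lim_{t\to+\infty}\big(f_i(x(t))+\frac12\|\dot x(t)\|^2\big)$.
   Context: $\mathcal H$ is a real Hilbert space. $f_1,\dots,f_m:\mathcal H\to\mathbb R$ are convex and continuously differentiable, and $F=(f_1,\dots,f_m)$. $C(x)=\operatorname{co}\{\nabla f_i(x):i=1,\dots,m\}$. For a closed convex $K$, $\operatorname{proj}_K(y)=\arg\min_{w\in K}\|w-y\|^2$. A solution of the Cauchy problem is a function $x:[t_0,+\infty)\to\mathcal H$ such that: $x\in C^1([t_0,+\infty))$; $\dot x$ is absolutely continuous on $[t_0,T]$ for every $T\ge t_0$; there is a Bochner measurable $\ddot x$ with $\dot x(t)=\dot x(t_0)+\int_{t_0}^t\ddot x(s)\,ds$ for all $t$, and $\frac{d}{dt}\dot x=\ddot x$ a.e.; the equation holds for almost all $t\ge t_0$; and the initial conditions hold. A point $x^*$ is weakly Pareto optimal if there is no $x$ with $f_i(x)<f_i(x^* )$ for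 all $i$; $P_w$ denotes the set of such points. For $\hat F\in\mathbb R^m$, $\mathcal L(\hat F)=\{x:F(x)\le\hat F\}$ and $P_w(\hat F)=P_w\cap\mathcal L(\hat F)$. Assumption: for all $x_0\in\mathcal H$ and all $x\in\mathcal L(F(x_0))$ there exists $x^*\in P_w(F(x))$, and $$R:=\sup_{F^*\in F(P_w(F(x_0)))}\ \inf_{x\in F^{-1}(F^* )}\tfrac12\|x-x_0\|^2<+\infty .$$ *)

(* Defs.v *)
From HB Require Import structures.
From mathcomp Require Import all_boot all_order all_algebra.
From mathcomp Require Import all_classical all_reals all_analysis.
Set Implicit Arguments. Unset Strict Implicit. Unset Printing Implicit Defensive.
Import Order.TTheory GRing.Theory Num.Theory.
Import numFieldNormedType.Exports.
Local Open Scope classical_set_scope.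
Local Open Scope ring_scope.

Section Defs.
Variable R : realType.

(* ip is a real inner product on the normed space H inducing its norm;
   with H complete this makes H a real Hilbert space. *)
Definition is_inner_product (H : normedModType R) (ip : H -> H -> R) : Prop :=
  (forall x y, ip x y = ip y x) /\
  (forall (a : R) x y z, ip (a *: x + y) z = a * ip x z + ip y z) /\
  (forall x, ip x x = `|x| ^+ 2).

Variable H : normedModType R.

Definition convex_fun (f : H -> R) : Prop :=
  forall (x y : H) (l : R), 0 <= l -> l <= 1 ->
    f (l *: x + (1 - l) *: y) <= l * f x + (1 - l) * f y.

Definition C1_with_gradient (ip : H -> H -> R) (f : H -> R) (g : H -> H) : Prop :=
  (forall x, differentiable f x /\ forall v, 'd f x v = ip (g x) v) /\
  continuous g.

Definition conv_grad (m : nat) (g : 'I_m -> H -> H) (x : H) : set H :=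
  [set v | exists l : 'I_m -> R, (forall i, 0 <= l i) /\ \sum_(i < m) l i = 1
                                  /\ v = \sum_(i < m) l i *: g i x].

Definition translate (K : set H) (a : H) : set H := [set v + a | v in K].

Definition is_proj (K : set H) (y w : H) : Prop :=
  K w /\ forall z, K z -> `|w - y| ^+ 2 <= `|z - y| ^+ 2.

Definition abs_cont_on (u : R -> H) (a b : R) : Prop :=
  forall e : R, 0 < e -> exists2 d : R, 0 < d &
    forall (n : nat) (s t : nat -> R),
      (forall k, (k < n)%N -> a <= s k /\ s k <= t k /\ t k <= b) ->
      (forall k, (k.+1 < n)%N -> t k <= s k.+1) ->
      \sum_(k < n) (t k - s k) < d ->
      \sum_(k < n) `|u (t k) - u (s k)| < e.

Definition C1_from (t0 : R) (u du : R -> H) : Prop :=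
  (forall t, t0 < t -> is_derive t 1 u (du t)) /\
  ((fun h : R => h^-1 *: (u (t0 + h) - u t0)) @ 0^'+ --> du t0) /\
  {within `[t0, +oo[%classic, continuous du}.

Variable m : nat.
Variable f : 'I_m -> H -> R.

Definition Fv (x : H) : 'I_m -> R := fun i => f i x.

Definition weak_pareto : set H :=
  [set xs | ~ exists y, forall i, f i y < f i xs].

Definition level (Fh : 'I_m -> R) : set H := [set y | forall i, f i y <= Fh i].

Definition weak_pareto_level (Fh : 'I_m -> R) : set H := weak_pareto `&` level Fh.

Definition R_const (x0 : H) : \bar R :=
  ereal_sup [set ereal_inf [set ((2%:R)^-1 * `|y - x0| ^+ 2)%:E
                           | y in [set y | Fv y = Fs]]
            | Fs in [set Fv xs | xs in weak_pareto_level (Fv x0)]].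

Definition pareto_assumption : Prop :=
  forall x0 : H,
    (forall x, level (Fv x0) x -> exists xs, weak_pareto_level (Fv x) xs) /\
    (R_const x0 < +oo)%E.

End Defs.

(* Main.v *)
Require Import Defs.
From HB Require Import structures.
From mathcomp Require Import all_boot all_order all_algebra.
From mathcomp Require Import all_classical all_reals all_analysis.
From mathcomp Require Import measurable_realfun ring lra.
Import Order.TTheory GRing.Theory Num.Theory.
Import numFieldNormedType.Exports.
Local Open Scope classical_set_scope.
Local Open Scope ring_scope.

(** Write [W i = f i (x t) + |xd t|^2 / 2].  The variational inequality of the
    projection gives [(W i)' <= - (alpha / t) |xd|^2] almost everywhere, so [W i]
    decreases to a limit [l i].  Moreover [xdd + (alpha / t) xd = - v] for some
    [v] in [C (x t)].  If some [z] had [f i z + eps <= l i] for all [i], then by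
    convexity the function
      [<x - z, xd> / t + (alpha + 1) |x - z|^2 / (2 t^2) + 3 / (2 alpha) W i + eps ln t]
    would be nonincreasing; but completing the square bounds all of it except
    the logarithm from below.  Applied to [z = x t], this yields for
    every [t] an [i] with [l i <= f i (x t)], that is,
    [|xd t|^2 / 2 <= W i t - l i], hence [xd] tends to [0]. *)

(** * Induction along an interval, and monotonicity in the presence of a null exceptional set *)

Lemma real_induction (R : realType) (P : R -> Prop) (a b : R) :
  a <= b -> P a ->
  (forall c, a <= c -> c <= b -> exists2 d : R, 0 < d &
     forall s t, a <= s -> s <= c -> c <= t -> t <= b ->
       c - s < d -> t - c < d -> P s -> P t) ->
  P b.
Proof.
move=> ab Pa step.
pose S : set R := [set t | [/\ a <= t, t <= b & P t]].
have Sa : S a by split.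
have Sb : ubound S b by move=> t [].
have hsS : has_sup S by split; [exists a | exists b].
have ac : a <= sup S by apply: sup_upper_bound.
have cb : sup S <= b by apply: ge_sup => //; exists a.
have [d d0 stepc] := step _ ac cb.
have [s [as_ sb Ps] cs] := sup_adherent d0 hsS.
have sc : s <= sup S by apply: sup_upper_bound.
have csd : sup S - s < d by lra.
(* From a point [s] of [S] within [d] of the supremum, [P] jumps across it: either the jump reaches
   [b], or [S] would contain [sup S + d / 2], above its own supremum. *)
case: (leP b (sup S + d / 2)) => bd.
  by apply: (stepc s b) => //; lra.
suff : S (sup S + d / 2) by move/(sup_upper_bound hsS); lra.
by split; [lra | lra |]; apply: (stepc s) => //; lra.
Qed.

Lemma negligible_open_cover (R : realType) (N : set R) (e : R) :
  (@lebesgue_measure R).-negligible N -> 0 < e ->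
  exists U : set R, [/\ open U, N `<=` U & (@lebesgue_measure R U < e%:E)%E].
Proof.
move=> [A [mA A0 NA]] e0.
have [|U [oU AU UA]] := lebesgue_regularity_outer mA _ e0.
  by rewrite /= A0 ltry.
exists U; split => //; first exact: subset_trans AU.
have -> : U = A `|` (U `\` A) by rewrite setDUK.
apply: le_lt_trans (measureU2 _ _ _) _ => //.
  by apply: measurableD => //; exact: open_measurable.
by rewrite /= A0 add0e.
Qed.

(** This replaces integrating an almost everywhere derivative. Steps across points outside [N] cost
    at most [e] times their length. Steps across points of [N] are charged to the variation of [u]
    and to their length; they lie in an open set of small measure, so absolute continuity of [u]
    makes their total cost at most [2 * L * e]. Real induction chains the steps from [a] to [b], and
    [e] is arbitrary. *)
Lemma absolutely_continuous_nonincreasing (R : realType) (H : normedModType R)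
    (u : R -> H) (phi : R -> R) (N : set R) (a b L : R) :
  a <= b -> 0 <= L -> abs_cont_on u a b ->
  (@lebesgue_measure R).-negligible N ->
  (forall c, a <= c -> c <= b -> exists2 d : R, 0 < d &
     forall s t, a <= s -> s <= c -> c <= t -> t <= b ->
       c - s < d -> t - c < d -> phi t - phi s <= L * (`|u t - u s| + (t - s))) ->
  (forall c, a <= c -> c <= b -> ~ N c -> forall e : R, 0 < e ->
     exists2 d : R, 0 < d &
     forall s t, a <= s -> s <= c -> c <= t -> t <= b ->
       c - s < d -> t - c < d -> phi t - phi s <= e * (t - s)) ->
  phi b <= phi a.
Proof.
move=> ab L0 acu N0 lip dini.
suff key : forall e : R, 0 < e -> phi b - phi a <= e * (b - a + L * 2).
  rewrite -subr_le0; apply/ler_addgt0Pr => e e0; rewrite add0r.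
  (* The extra [1] keeps the divisor positive when [a = b] and [L = 0]. *)
  have K0 : 0 < b - a + L * 2 + 1 by lra.
  apply: le_trans (key (e / (b - a + L * 2 + 1)) _) _; first exact: divr_gt0.
  rewrite -mulrA ler_piMr ?(ltW e0) // mulrC ler_pdivrMr // mul1r; lra.
move=> e e0.
have [d d0 dP] := acu _ e0.
(* Measure below [d] activates the absolute continuity of [u]; measure below [e] bounds the total
   length of the collected intervals. *)
have [|U [oU NU Ud]] := @negligible_open_cover R N (Num.min d e) N0.
  by rewrite lt_min d0 e0.
have mU t : measurable (U `&` `[a, t]).
  by apply: measurableI; [exact: open_measurable | exact: measurable_itv].
pose mu := @lebesgue_measure R.
(* Intervals tagged by a point outside [N] contribute to [e * (t - a)]; those
   tagged in [N] lie in [U] and are collected in the family [s, r]. *)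
pose P (t : R) := exists n (s r : nat -> R),
  [/\ forall k, (k < n)%N -> a <= s k /\ s k <= r k /\ r k <= t,
      forall k, (k.+1 < n)%N -> r k <= s k.+1,
      ((\sum_(k < n) (r k - s k))%:E <= mu (U `&` `[a, t]))%E &
      phi t - phi a <= e * (t - a) +
        L * (\sum_(k < n) `|u (r k) - u (s k)| + \sum_(k < n) (r k - s k))].
have [n [s [r [sr rs mur phib]]]] : P b.
  apply: (@real_induction R P a b) => //.
    exists 0%N, (fun=> 0), (fun=> 0); split => //.
      by rewrite big_ord0.
    by rewrite !big_ord0; lra.
  move=> c ac cb; have [cN|cN] := pselect (N c); last first.
    have [d' d'0 d'P] := dini c ac cb cN e e0.
    exists d' => // s t as_ sc ct tb sd td [n [p [q [pq qp mpq phis]]]].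
    exists n, p, q; split => //.
    - by move=> k /pq [? [? ?]]; split => //; split => //; lra.
    - apply: le_trans mpq _; apply: le_measure; rewrite ?inE; [exact: mU|exact: mU|].
      by apply: classical_sets.setIS => z /=; rewrite !in_itv /= => /andP[-> zs]; lra.
    - have := d'P s t as_ sc ct tb sd td; lra.
  have [d1 d10 d1P] := lip c ac cb.
  have /nbhs_ballP [d2 /= d20 d2P] : nbhs c U by apply: oU; exact: NU.
  exists (Num.min d1 d2); first by rewrite lt_min d10 d20.
  move=> s t as_ sc ct tb; rewrite !lt_min => /andP[sd1 sd2] /andP[td1 td2].
  move=> [n [p [q [pq qp mpq phis]]]].
  have inc := d1P s t as_ sc ct tb sd1 td1.
  (* Since [c] is in [N], the interval from [s] to [t] is appended to the family as its last
     member. *)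
  exists n.+1, (fun k => if (k < n)%N then p k else s), (fun k => if (k < n)%N then q k else t).
  have sumE (F : R -> R -> R) :
      \sum_(k < n.+1) F (if (k < n)%N then q k else t) (if (k < n)%N then p k else s)
      = \sum_(k < n) F (q k) (p k) + F t s.
    rewrite big_ord_recr /= ltnn; congr (_ + _).
    by apply: eq_bigr => k _; rewrite ltn_ord.
  split.
  - move=> k kn; case: ifPn => [/pq [? [? ?]]|_]; first by split => //; split => //; lra.
    by split => //; split => //; lra.
  - move=> k; rewrite ltnS => kn; rewrite kn.
    by case: ifPn => [/qp //|_]; have [_ [_]] := pq _ kn.
  - rewrite (sumE (fun x y => x - y)) EFinD.
    (* Leaving out the left endpoint makes the new interval disjoint from [[a, s]], so that the
       measures add. *)
    have -> : (t - s)%:E = mu `]s, t]%classic.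
      rewrite /mu lebesgue_measure_itv /= lte_fin.
      case: ltP => [_|ts]; first by rewrite EFinB.
      by have -> : t - s = 0 by lra.
    apply: le_trans (leeD2r _ mpq) _.
    rewrite -measureU.
    + apply: le_measure; rewrite ?inE; [|exact: mU|].
        by apply: measurableU; [exact: mU|exact: measurable_itv].
      move=> z [[Uz]|] /=; rewrite !in_itv /= => /andP[za zt].
        by split => //=; apply/andP; split; lra.
      split; last by rewrite /= ?in_itv /=; apply/andP; split; lra.
      apply: d2P; rewrite /ball /= ltr_norml; lra.
    + exact: mU.
    + exact: measurable_itv.
    + apply/seteqP; split => z //= -[[_]].
      by rewrite !in_itv /= => /andP[_ zs] /andP[sz _]; lra.
  - rewrite (sumE (fun x y => x - y)).
    rewrite (sumE (fun x y => `|u x - u y|)).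
    have : 0 <= e * (t - s) by rewrite mulr_ge0 //; lra.
    move: phis inc; set A1 := \sum_(k < n) _; set A2 := \sum_(k < n) _; lra.
have : ((\sum_(k < n) (r k - s k))%:E < (Num.min d e)%:E)%E.
  apply: le_lt_trans mur (le_lt_trans _ Ud).
  apply: le_measure; rewrite ?inE; [exact: mU|exact: open_measurable|].
  exact: subIsetl.
rewrite lte_fin lt_min => /andP[sd se].
have us := dP n s r sr rs sd.
apply: le_trans phib _.
set A1 := \sum_(k < n) _ in us *; set A2 := \sum_(k < n) _ in se *.
have : L * (A1 + A2) <= L * (e + e) by apply: ler_wpM2l => //; lra.
lra.
Qed.

(** * Derivatives of curves in a normed space, and elementary facts on an interval or half-line *)

Lemma is_derive_cvgP {R : realType} {W : normedModType R} {u : R -> W} {t : R} {du : W} :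
  is_derive t 1 u du <-> h^-1 *: (u (h + t) - u t) @[h --> 0^'] --> du.
Proof.
have E : (fun h : R => h^-1 *: ((u \o shift t) (h *: 1) - u t)) =
         (fun h => h^-1 *: (u (h + t) - u t)).
  by apply/funext => h /=; rewrite /GRing.scale /= mulr1.
split.
  by move=> [+ <-]; rewrite /derivable /derive E.
move=> h; apply: DeriveDef; rewrite /derivable /derive E; last exact: cvg_lim.
by apply/cvg_ex; exists du.
Qed.

Lemma is_derive_continuous {R : realType} {W : normedModType R} {u : R -> W} {t : R} {du : W} :
  is_derive t 1 u du -> {for t, continuous u}.
Proof. by move=> [/derivable1_diffP/differentiable_continuous]. Qed.

Lemma is_derive_cvg_shift {R : realType} {W : normedModType R} {u : R -> W} {t : R} {du : W} :
  is_derive t 1 u du -> u (h + t) @[h --> 0^'] --> u t.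
Proof.
move=> Du.
suff /continuous_withinNx : {for 0, continuous (fun h => u (h + t))} by rewrite add0r.
apply: (@continuous_comp _ _ _ (shift t) u); last first.
  by rewrite /= add0r; exact: is_derive_continuous Du.
by apply: cvgD; [exact: cvg_id | exact: cvg_cst].
Qed.

Lemma is_derive_scale {R : realType} {W : normedModType R}
    {k : R -> R} {u : R -> W} {t dk : R} {du : W} :
  is_derive t 1 k dk -> is_derive t 1 u du ->
  is_derive t 1 (fun s => k s *: u s) (dk *: u t + k t *: du).
Proof.
move=> Dk Du; apply/is_derive_cvgP.
have E h : h^-1 *: (k (h + t) *: u (h + t) - k t *: u t) =
    (h^-1 *: (k (h + t) - k t)) *: u (h + t) + k t *: (h^-1 *: (u (h + t) - u t)).
  rewrite scalerA (mulrC (k t)) -!scalerA -scalerDr; congr (_ *: _).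
  by rewrite scalerBl scalerBr addrA subrK.
under eq_fun do rewrite E.
apply: cvgD; apply: cvgZ.
- exact/is_derive_cvgP.
- exact: is_derive_cvg_shift Du.
- exact: cvg_cst.
- exact/is_derive_cvgP.
Qed.

(** Subtract the first-order expansions of [u] at [c] taken at [t] and at [s]. As [s <= c <= t], the
    errors [e * (t - c)] and [e * (c - s)] add up to exactly [e * (t - s)], the form that real
    induction consumes. *)
Lemma is_derive_straddle {R : realType} {W : normedModType R}
    {u : R -> W} {c : R} {du : W} {e : R} :
  is_derive c 1 u du -> 0 < e -> exists2 d : R, 0 < d &
    forall s t, s <= c -> c <= t -> c - s < d -> t - c < d ->
      `|u t - u s - (t - s) *: du| <= e * (t - s).
Proof.
move=> /is_derive_cvgP Du e0.
have [d /= d0 dP] : exists2 d : R, 0 < d &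
    forall h, `|h| < d -> `|u (h + c) - u c - h *: du| <= e * `|h|.
  move/cvgrPdist_le : Du => /(_ _ e0) /nbhs_ballP [d /= d0 dP].
  exists d => // h hd; have [->|h0] := eqVneq h 0.
    by rewrite add0r subrr scale0r subrr !normr0 mulr0.
  have /(_ _ h0) : `|h| < d -> h != 0 -> `|du - h^-1 *: (u (h + c) - u c)| <= e.
    by move=> ? ?; apply: dP => //=; rewrite /ball /= sub0r normrN.
  move=> /(_ hd) le_e.
  have -> : u (h + c) - u c - h *: du = - h *: (du - h^-1 *: (u (h + c) - u c)).
    by rewrite scalerBr scalerA mulNr divff // !scaleNr scale1r opprK addrC.
  by rewrite normrZ normrN mulrC ler_wpM2r.
exists d => // s t sc ct sd td.
have ht := dP (t - c); have hs := dP (s - c).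
rewrite !subrK ger0_norm ?subr_ge0 // in ht; rewrite !subrK ler0_norm ?subr_le0 // in hs.
have -> : u t - u s - (t - s) *: du =
    (u t - u c - (t - c) *: du) - (u s - u c - (s - c) *: du).
  have -> : t - s = (t - c) - (s - c) by ring.
  rewrite scalerBl; move: (u t) (u s) (u c) (_ *: du) (_ *: du) => k l m p q.
  rewrite (opprD (l - m)) opprK !opprB [RHS]addrACA [k - m + _]addrA subrK.
  by congr (_ + _); rewrite addrC.
apply: le_trans (ler_normB _ _) _.
have := ht td; have := hs; rewrite opprB => /(_ sd); lra.
Qed.

Lemma continuous_bounded_itv (R : realType) (W : normedModType R) (u : R -> W) (a b : R) :
  a <= b -> (forall t, a <= t -> t <= b -> {for t, continuous u}) ->
  exists2 B : R, 0 <= B & forall t, a <= t -> t <= b -> `|u t| <= B.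
Proof.
move=> ab cu.
have [||c _ cP] := @EVT_max R (fun t => `|u t|) a b => //.
  apply: continuous_in_subspaceT => t; rewrite inE /= in_itv /= => /andP[ta tb].
  by apply: cvg_norm; exact: cu.
exists `|u c| => // t ta tb; apply: cP; rewrite in_itv /=; exact/andP.
Qed.

Lemma abs_cont_on_subset {R : realType} {H : normedModType R} {u : R -> H} {a a' b : R} :
  a <= a' -> abs_cont_on u a b -> abs_cont_on u a' b.
Proof.
move=> aa' acu e e0; have [d d0 dP] := acu e e0; exists d => // n s t st ts sd.
apply: dP => // k kn; have [ask stk] := st k kn; split => //; exact: le_trans ask.
Qed.

Lemma nonincreasing_cvgy (R : realType) (w : R -> R) (t0 b : R) :
  (forall s t, t0 < s -> s <= t -> w t <= w s) -> (forall t, b <= w t) ->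
  exists2 l : R, w t @[t --> +oo] --> l & forall t, t0 < t -> l <= w t.
Proof.
move=> wni wb; pose E := [set w t | t in [set t | t0 < t]].
have E0 : E !=set0 by exists (w (t0 + 1)), (t0 + 1) => //=; lra.
have Eb : has_lbound E by exists b => _ [t _ <-].
have El t : t0 < t -> inf E <= w t by move=> tt0; apply: ge_inf => //; exists t.
exists (inf E) => //; apply/cvgrPdist_lt => e e0.
have [_ [s /= s0 <-] ws] := inf_adherent e0 (conj E0 Eb).
near=> t; have st : s <= t by near: t; by apply: nbhs_pinfty_ge; rewrite num_real.
rewrite ltr_norml; have := El t (lt_le_trans s0 st); have := wni s t s0 st; lra.
Unshelve. all: by end_near. Qed.

(** * Calculus of the inner product: bilinearity, Cauchy-Schwarz, continuity, product rule *)

Section Hilbert.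
Context (R : realType) (H : normedModType R) (ip : H -> H -> R).
Hypothesis ipP : is_inner_product ip.

Lemma ipC x y : ip x y = ip y x.
Proof. by have [+ _] := ipP; apply. Qed.

Lemma ipxx x : ip x x = `|x| ^+ 2.
Proof. by have [_ [_]] := ipP; apply. Qed.

Lemma ipDZl (a : R) x y z : ip (a *: x + y) z = a * ip x z + ip y z.
Proof. by have [_ [+ _]] := ipP; apply. Qed.

Lemma ip0l z : ip 0 z = 0.
Proof.
by apply: (@addrI _ (ip 0 z)); rewrite addr0 -{1}[ip 0 z]mul1r -ipDZl scale1r addr0.
Qed.

Lemma ipDl x y z : ip (x + y) z = ip x z + ip y z.
Proof. by have := ipDZl 1 x y z; rewrite scale1r mul1r. Qed.

Lemma ipZl a x z : ip (a *: x) z = a * ip x z.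
Proof. by have := ipDZl a x 0 z; rewrite addr0 ip0l addr0. Qed.

Lemma ipNl x z : ip (- x) z = - ip x z.
Proof. by rewrite -scaleN1r ipZl mulN1r. Qed.

Lemma ipBl x y z : ip (x - y) z = ip x z - ip y z.
Proof. by rewrite ipDl ipNl. Qed.

Lemma ipDr z x y : ip z (x + y) = ip z x + ip z y.
Proof. by rewrite !(ipC z) ipDl. Qed.

Lemma ipZr a z x : ip z (a *: x) = a * ip z x.
Proof. by rewrite !(ipC z) ipZl. Qed.

Lemma ipNr z x : ip z (- x) = - ip z x.
Proof. by rewrite !(ipC z) ipNl. Qed.

Lemma ipBr z x y : ip z (x - y) = ip z x - ip z y.
Proof. by rewrite ipDr ipNr. Qed.

Lemma ip_suml m (l : 'I_m -> R) (v : 'I_m -> H) z :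
  ip (\sum_i l i *: v i) z = \sum_i l i * ip (v i) z.
Proof.
apply: (big_ind2 (fun p q => ip p z = q)); first exact: ip0l.
- by move=> p p' q q' <- <-; rewrite ipDl.
- by move=> i _; rewrite ipZl.
Qed.

(** Cauchy-Schwarz: for nonzero vectors, the square of the norm of [|y| x - |x| y] expands to
    [2 |x| |y| (|x| |y| - ip x y)], which is therefore nonnegative. *)
Lemma ip_le_norm x y : ip x y <= `|x| * `|y|.
Proof.
have [->|x0] := eqVneq x 0; first by rewrite ip0l normr0 mul0r.
have [->|y0] := eqVneq y 0; first by rewrite ipC ip0l normr0 mulr0.
have xy0 : 0 < `|x| * `|y| by rewrite mulr_gt0 ?normr_gt0.
have := sqr_ge0 `| `|y| *: x - `|x| *: y |.
rewrite -ipxx ipBl !ipBr !ipZl !ipZr !ipxx (ipC y x) => h.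
rewrite -subr_ge0 -(pmulr_rge0 _ xy0); nra.
Qed.

Lemma ip_abs_le x y : `|ip x y| <= `|x| * `|y|.
Proof.
rewrite ler_norml ip_le_norm andbT lerNl -ipNl.
by apply: le_trans (ip_le_norm _ _) _; rewrite normrN.
Qed.

(** [ip] is known only through its algebraic laws, so its joint continuity is drawn from
    Cauchy-Schwarz, applied to the two error terms of [E]. *)
Lemma cvg_ip {T : Type} {F : set_system T} {FF : Filter F} (u v : T -> H) a b :
  u @ F --> a -> v @ F --> b -> ip (u t) (v t) @[t --> F] --> ip a b.
Proof.
move=> ua vb.
have E t : ip (u t) (v t) = ip a b + (ip (u t - a) (v t) + ip a (v t - b)).
  by rewrite ipBl ipBr; ring.
have ua0 : `|u t - a| @[t --> F] --> (0 : R).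
  by rewrite -(normr0 H) -(subrr a); apply: cvg_norm; apply: cvgB => //; exact: cvg_cst.
have vb0 : `|v t - b| @[t --> F] --> (0 : R).
  by rewrite -(normr0 H) -(subrr b); apply: cvg_norm; apply: cvgB => //; exact: cvg_cst.
have h1 : ip (u t - a) (v t) @[t --> F] --> (0 : R).
  apply: norm_cvg0; apply: (squeeze_cvgr (f := cst 0) (h := fun t => `|u t - a| * `|v t|)).
  - by apply: nearW => t; rewrite normr_ge0 ip_abs_le.
  - exact: cvg_cst.
  - by rewrite -(mul0r `|b|); apply: cvgM => //; exact: cvg_norm.
have h2 : ip a (v t - b) @[t --> F] --> (0 : R).
  apply: norm_cvg0; apply: (squeeze_cvgr (f := cst 0) (h := fun t => `|a| * `|v t - b|)).
  - by apply: nearW => t; rewrite normr_ge0 ip_abs_le.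
  - exact: cvg_cst.
  - by rewrite -(mulr0 `|a|); apply: cvgM => //; exact: cvg_cst.
under eq_fun do rewrite E.
have := cvgD (cvg_cst (ip a b)) (cvgD h1 h2).
by rewrite !addr0; apply.
Qed.

Lemma is_derive_ip (u v : R -> H) (t : R) (du dv : H) :
  is_derive t 1 u du -> is_derive t 1 v dv ->
  is_derive t 1 (fun s => ip (u s) (v s)) (ip du (v t) + ip (u t) dv).
Proof.
move=> Du Dv; apply/is_derive_cvgP.
have E h : h^-1 *: (ip (u (h + t)) (v (h + t)) - ip (u t) (v t)) =
    ip (h^-1 *: (u (h + t) - u t)) (v (h + t)) + ip (u t) (h^-1 *: (v (h + t) - v t)).
  by rewrite ipZl ipZr ipBl ipBr /GRing.scale /=; ring.
under eq_fun do rewrite E.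
apply: cvgD; apply: cvg_ip.
- exact/is_derive_cvgP.
- exact: is_derive_cvg_shift Dv.
- exact: cvg_cst.
- exact/is_derive_cvgP.
Qed.

(** * Gradient inequality, projection inequality and a general energy estimate *)

Lemma convex_gradient_le (f : H -> R) (g : H -> H) x y :
  convex_fun f -> C1_with_gradient ip f g -> f x + ip (g x) (y - x) <= f y.
Proof.
move=> cf [dg _]; have [df dfE] := dg x.
rewrite addrC -lerBrDr -dfE -deriveE //.
(* By convexity every difference quotient from [x] towards [y] with step [l] in []0, 1]] is at most
   [f y - f x]; the bound passes to the limit from the right. *)
have /cvg_dnbhs_at_right h := diff_derivable (v := y - x) df.
apply: cvgr_to_le h _; near=> l.
have l0 : 0 < l by near: l; exact: nbhs_right_gt.
have l1 : l <= 1 by near: l; exact: nbhs_right_le.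
rewrite /= /GRing.scale /= mulrC ler_pdivrMr //.
have := cf y x l (ltW l0) l1.
have -> : l *: y + (1 - l) *: x = l *: (y - x) + x.
  by rewrite scalerBl scale1r scalerBr addrCA addrC.
lra.
Unshelve. all: by end_near. Qed.

Lemma is_derive_comp_gradient (f : H -> R) (g : H -> H) (x : R -> H) (t : R) xd :
  C1_with_gradient ip f g -> is_derive t 1 x xd ->
  is_derive t 1 (f \o x) (ip (g (x t)) xd).
Proof.
move=> [dg _] Dx; have [df dfE] := dg (x t).
have dx : differentiable x t by apply/derivable1_diffP; case: Dx.
have dfx : differentiable (f \o x) t by apply: differentiable_comp.
apply: DeriveDef; first exact/derivable1_diffP.
rewrite deriveE // diff_comp //= dfE -deriveE //.
by have [_ ->] := Dx.
Qed.

(** If [ip w (z - w)] were negative, a short move from [w] towards [z] would lower the norm. Only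
    the segment from [w] to [z] has to lie in [K]. *)
Lemma proj_variational (K : set H) (w z : H) :
  (forall l : R, 0 < l -> l <= 1 -> K (l *: z + (1 - l) *: w)) ->
  is_proj K 0 w -> `|w| ^+ 2 <= ip w z.
Proof.
move=> Kc [_ wmin]; rewrite -ipxx -subr_ge0 -ipBr leNgt; apply/negP.
set p := ip w (z - w) => p0.
have Q0 : 0 <= `|z - w| ^+ 2 by exact: sqr_ge0.
set Q := `|z - w| ^+ 2 in Q0.
have D0 : 0 < Q - p + 1 by lra.
(* Moving by [l] changes the squared norm by [l * (2 * p + l * Q)]. This [l] is in []0, 1]] and
   satisfies [l * Q < - p], so the change is below [l * p < 0]. *)
pose l := - p / (Q - p + 1).
have lD : l * (Q - p + 1) = - p by rewrite /l divfK // lt0r_neq0.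
have l0 : 0 < l by rewrite divr_gt0 //; lra.
have l1 : l <= 1 by rewrite ler_pdivrMr // mul1r; lra.
have := wmin _ (Kc l l0 l1); rewrite !subr0.
have -> : l *: z + (1 - l) *: w = w + l *: (z - w).
  by rewrite scalerBl scale1r scalerBr addrCA.
rewrite -!ipxx ipDl !ipDr !ipZl !ipZr (ipC (z - w) w) -/p (ipxx (z - w)) -/Q.
have : l * p < 0 by rewrite pmulr_rlt0.
nra.
Qed.

(** One estimate serves both energies used below, with [u] the velocity. Only [u] may fail to be
    differentiable on [N]; [y] and [P] are differentiable with bounded derivatives, so each
    increment of the energy is controlled by that of [u] and of time. Off [N] the product rule gives
    a nonpositive derivative. *)
Lemma energy_nonincreasing (u y du dy : R -> H) (P dP : R -> R) (N : set R) (c a b : R) :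
  a <= b -> abs_cont_on u a b -> (@lebesgue_measure R).-negligible N ->
  (forall t, a <= t -> t <= b ->
     [/\ {for t, continuous u}, {for t, continuous dy} & {for t, continuous dP}]) ->
  (forall t, a <= t -> t <= b -> is_derive t 1 y (dy t) /\ is_derive t 1 P (dP t)) ->
  (forall t, a <= t -> t <= b -> ~ N t -> is_derive t 1 u (du t) /\
     ip (dy t) (u t) + ip (y t) (du t) + c * (2 * ip (u t) (du t)) + dP t <= 0) ->
  ip (y b) (u b) + c * ip (u b) (u b) + P b <=
  ip (y a) (u a) + c * ip (u a) (u a) + P a.
Proof.
move=> ab acu N0 ct der ae.
pose phi t := ip (y t) (u t) + c * ip (u t) (u t) + P t.
have [Bu Bu0 uB] : exists2 B : R, 0 <= B & forall t, a <= t -> t <= b -> `|u t| <= B.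
  by apply: continuous_bounded_itv => // t ta tb; have [] := ct t ta tb.
have [By By0 yB] : exists2 B : R, 0 <= B & forall t, a <= t -> t <= b -> `|y t| <= B.
  apply: continuous_bounded_itv => // t ta tb; have [D _] := der t ta tb.
  exact: is_derive_continuous D.
have [Bdy Bdy0 dyB] : exists2 B : R, 0 <= B & forall t, a <= t -> t <= b -> `|dy t| <= B.
  by apply: continuous_bounded_itv => // t ta tb; have [] := ct t ta tb.
have [BP BP0 dPB] : exists2 B : R, 0 <= B & forall t, a <= t -> t <= b -> `|dP t| <= B.
  by apply: continuous_bounded_itv => // t ta tb; have [] := ct t ta tb.
(* The four terms bound, in order, the four pieces of the increment: the change of [u] against [y],
   the difference of squares [ip (u t - u s) (u t + u s)], the change of [y] against [u], and the
   change of [P]. Each [+ 1] is the error allowed in [is_derive_straddle]. *)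
pose L := By + `|c| * (Bu + Bu) + (Bdy + 1) * Bu + (BP + 1).
have L1 : 0 <= By + `|c| * (Bu + Bu) by rewrite addr_ge0 // mulr_ge0 // addr_ge0.
have L2 : 0 <= (Bdy + 1) * Bu + (BP + 1) by rewrite addr_ge0 ?mulr_ge0 ?addr_ge0.
apply: (@absolutely_continuous_nonincreasing R H u phi N a b L) => //.
- by rewrite /L; lra.
- move=> k ak kb; have [Dy DP] := der k ak kb.
  have [d1 d10 d1P] := is_derive_straddle Dy ltr01.
  have [d2 d20 d2P] := is_derive_straddle DP ltr01.
  exists (Num.min d1 d2); first by rewrite lt_min d10 d20.
  move=> s t as_ sk kt tb; rewrite !lt_min => /andP[s1 s2] /andP[t1 t2].
  have ys := d1P s t sk kt s1 t1; have Ps := d2P s t sk kt s2 t2.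
  have st : 0 <= t - s by lra.
  have sb : s <= b by lra.
  have at_ : a <= t by lra.
  have yst : `|y t - y s| <= (Bdy + 1) * (t - s).
    rewrite -[y t - y s](subrK ((t - s) *: dy k)).
    apply: le_trans (ler_normD _ _) _; rewrite normrZ ger0_norm //.
    have : (t - s) * `|dy k| <= (t - s) * Bdy by rewrite ler_wpM2l // dyB.
    lra.
  have Pst : P t - P s <= (BP + 1) * (t - s).
    have : (t - s) * dP k <= (t - s) * BP.
      by rewrite ler_wpM2l // (le_trans (ler_norm _)) // dPB.
    have := le_trans (ler_norm _) Ps; rewrite /GRing.scale /=; lra.
  have -> : phi t - phi s = ip (y s) (u t - u s) + c * ip (u t - u s) (u t + u s)
      + ip (y t - y s) (u t) + (P t - P s).
    rewrite /phi !ipBl !ipBr !ipDr.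
    by rewrite (ipC (u s) (u t)); ring.
  have i1 : ip (y s) (u t - u s) <= By * `|u t - u s|.
    by apply: le_trans (ip_le_norm _ _) _; rewrite ler_wpM2r // yB.
  have i2 : c * ip (u t - u s) (u t + u s) <= `|c| * (Bu + Bu) * `|u t - u s|.
    apply: le_trans (ler_norm _) _; rewrite normrM -mulrA ler_wpM2l //.
    apply: le_trans (ip_abs_le _ _) _; rewrite mulrC ler_wpM2r //.
    by apply: le_trans (ler_normD _ _) _; apply: lerD; exact: uB.
  have i3 : ip (y t - y s) (u t) <= (Bdy + 1) * Bu * (t - s).
    apply: le_trans (ip_le_norm _ _) _; rewrite mulrAC.
    by apply: ler_pM => //; exact: uB.
  have := mulr_ge0 L1 st; have := mulr_ge0 L2 (normr_ge0 (u t - u s)).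
  rewrite /L; lra.
- move=> k ak kb kN e e0; have [Dy DP] := der k ak kb; have [Du le0] := ae k ak kb kN.
  have D : is_derive k 1 phi
     (ip (dy k) (u k) + ip (y k) (du k) + c * (ip (du k) (u k) + ip (u k) (du k)) + dP k).
    have D1 := is_derive_ip _ _ _ _ _ Dy Du.
    have D2 := is_derive_ip _ _ _ _ _ Du Du.
    exact: (is_deriveD (is_deriveD D1 (is_deriveZ c D2)) DP).
  have [d d0 dp] := is_derive_straddle D e0.
  exists d => // s t as_ sk kt tb sd td.
  have := le_trans (ler_norm _) (dp s t sk kt sd td).
  rewrite (ipC (du k)) -mulr2n -mulr_natl.
  have : (t - s) * (ip (dy k) (u k) + ip (y k) (du k) + c * (2 * ip (u k) (du k)) + dP k) <= 0.
    by apply: mulr_ge0_le0 => //; lra.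
  rewrite /GRing.scale /=; lra.
Qed.

(** * The convex hull of the gradients *)

Lemma conv_grad_vertex m (g : 'I_m -> H -> H) x i : conv_grad g x (g i x).
Proof.
exists (fun j => (j == i)%:R); split; first by move=> j; exact: ler0n.
split; rewrite (bigD1 i) //= eqxx big1 ?addr0 // ?scale1r // => j /negPf -> //.
by rewrite scale0r.
Qed.

Lemma translate_conv_grad_convex m (g : 'I_m -> H -> H) x a p q (l : R) :
  0 <= l -> l <= 1 -> translate (conv_grad g x) a p -> translate (conv_grad g x) a q ->
  translate (conv_grad g x) a (l *: p + (1 - l) *: q).
Proof.
move=> l0 l1 [_ [k [k0 [k1 ->]]] <-] [_ [k' [k'0 [k'1 ->]]] <-].
exists (\sum_i (l * k i + (1 - l) * k' i) *: g i x).
  exists (fun i => l * k i + (1 - l) * k' i); split; last split => //.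
    by move=> i; rewrite addr_ge0 // mulr_ge0 //; lra.
  by rewrite big_split /= -!mulr_sumr k1 k'1; ring.
under eq_bigr do rewrite scalerDl -!scalerA.
rewrite big_split /= -!scaler_sumr !scalerDr addrACA -scalerDl.
by rewrite (addrC l) subrK scale1r.
Qed.

(** Here [w = - k u]; test the projection inequality with the vertex [g i x + a] and divide by [k].
    With [u] the velocity and [a] the acceleration, the left side is the time derivative of
    [f i (x t) + |xd t|^2 / 2]. *)
Lemma proj_conv_grad_power m (g : 'I_m -> H -> H) x a u w (k : R) i :
  is_proj (translate (conv_grad g x) a) 0 w -> 0 < k -> k *: u + w = 0 ->
  ip u (g i x + a) <= - k * ip u u.
Proof.
move=> wP k0 /(canRL (addKr _)); rewrite addr0 => wE.
have Kg : translate (conv_grad g x) a (g i x + a).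
  by exists (g i x) => //; exact: conv_grad_vertex.
have := @proj_variational _ w (g i x + a) _ wP.
have Kw := wP.1.
move=> h; have {h} : `|w| ^+ 2 <= ip w (g i x + a).
  by apply: h => l l0 l1; apply: translate_conv_grad_convex => //; exact: ltW.
rewrite -ipxx wE !ipNl ipNr !ipZl ipZr opprK -mulrN ler_pM2l //; lra.
Qed.

(** The gradient inequality bounds [ip (g i x) (z - x)] by [r] for each [i], and averaging with
    weights of sum 1 keeps a common bound. *)
Lemma conv_grad_descent m (f : 'I_m -> H -> R) (g : 'I_m -> H -> H) x z v (r : R) :
  (forall i, convex_fun (f i)) -> (forall i, C1_with_gradient ip (f i) (g i)) ->
  conv_grad g x v -> (forall i, f i z - f i x <= r) -> ip v (z - x) <= r.
Proof.
move=> cf Cf [l [l0 [l1 ->]]] fr; rewrite ip_suml -[r]mul1r -l1 mulr_suml.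
apply: ler_sum => i _; apply: ler_wpM2l => //; apply: le_trans (fr i).
by have := convex_gradient_le (f i) (g i) x z (cf i) (Cf i); lra.
Qed.

(** * Energies along a solution and their limits *)

Context (m : nat) (f : 'I_m -> H -> R) (g : 'I_m -> H -> H).
Context (alpha t0 : R) (x xd xdd : R -> H) (N : set R).
Hypothesis cf : forall i, convex_fun (f i).
Hypothesis Cf : forall i, C1_with_gradient ip (f i) (g i).
Hypothesis alpha0 : 0 < alpha.
Hypothesis t00 : 0 < t0.
Hypothesis xC1 : C1_from t0 x xd.
Hypothesis xdAC : forall T, t0 <= T -> abs_cont_on xd t0 T.
Hypothesis N0 : (@lebesgue_measure R).-negligible N.
Hypothesis sol : forall t, t0 < t -> ~ N t ->
  is_derive t 1 xd (xdd t) /\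
  exists w, is_proj (translate (conv_grad g (x t)) (xdd t)) 0 w /\
            (alpha / t) *: xd t + w = 0.

Definition mechanical_energy i t := f i (x t) + 2%:R^-1 * `|xd t| ^+ 2.
Local Notation W := mechanical_energy.

Let Dx t : t0 < t -> is_derive t 1 x (xd t).
Proof. by have [+ _] := xC1; apply. Qed.

Let xd_continuous t : t0 < t -> {for t, continuous xd}.
Proof.
move=> tt0; have [_ [_ /continuous_within_itvcyP[+ _]]] := xC1; apply.
by rewrite in_itv /= tt0.
Qed.

Let Dfx i t : t0 < t -> is_derive t 1 (f i \o x) (ip (g i (x t)) (xd t)).
Proof. by move=> tt0; apply: is_derive_comp_gradient => //; exact: Dx. Qed.

Let gx_continuous i t : t0 < t ->
  {for t, continuous (fun s => ip (g i (x s)) (xd s))}.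
Proof.
move=> tt0; apply: cvg_ip; last exact: xd_continuous.
apply: (@continuous_comp _ _ _ x (g i)); first exact: is_derive_continuous (Dx t tt0).
by have [_] := Cf i; apply.
Qed.

Let power i t : t0 < t -> ~ N t ->
  ip (xd t) (g i (x t) + xdd t) <= - (alpha / t) * ip (xd t) (xd t).
Proof.
move=> tt0 tN; have [_ [w [wP wE]]] := sol t tt0 tN.
by apply: proj_conv_grad_power wP _ wE; rewrite divr_gt0 //; exact: lt_trans tt0.
Qed.

Lemma mechanical_energy_nonincreasing i s t : t0 < s -> s <= t -> W i t <= W i s.
Proof.
move=> st0 st.
have WE r : W i r = ip 0 (xd r) + 2^-1 * ip (xd r) (xd r) + (f i \o x) r.
  by rewrite ip0l ipxx add0r addrC.
rewrite !WE; apply: (energy_nonincreasing xd (fun=> 0) xdd (fun=> 0) (f i \o x)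
  (fun t => ip (g i (x t)) (xd t)) N 2^-1) => //.
- by apply: (@abs_cont_on_subset _ _ _ t0); [exact: ltW|apply: xdAC; lra].
- move=> r sr rt; have rt0 : t0 < r by lra.
  split; [exact: xd_continuous|exact: cvg_cst|exact: gx_continuous].
- move=> r sr rt; have rt0 : t0 < r by lra.
  by split; [exact: is_derive_cst|exact: Dfx].
- move=> r sr rt rN; have rt0 : t0 < r by lra.
  split; first by have [] := sol r rt0 rN.
  have := power i r rt0 rN; rewrite !ip0l ipDr (ipC (xd r) (g i (x r))).
  have : 0 <= alpha / r * ip (xd r) (xd r).
    by rewrite ipxx mulr_ge0 ?sqr_ge0 // divr_ge0 // ltW // (lt_trans t00).
  lra.
Qed.

Lemma energy_limits_not_dominated (i : 'I_m) (l : 'I_m -> R) (b : R) (z : H) :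
  (forall y, b <= f i y) -> (forall j t, t0 < t -> l j <= W j t) ->
  ~ (forall j, f j z < l j).
Proof.
move=> fb lW zl; have al0 := alpha0.
(* The uniform gap is the minimum of finitely many positive gaps; the index [i] witnesses that there
   is at least one. *)
have [eps eps0 epsP] : exists2 e : R, 0 < e & forall j, e <= l j - f j z.
  have [//|j _ jP] := @arg_minP _ _ _ i xpredT (fun j => l j - f j z).
  by exists (l j - f j z) => [|k]; [rewrite subr_gt0|exact: jP].
pose y t := t^-1 *: (x t - z).
pose dy t := t^-1 *: xd t - t^-1 ^+ 2 *: (x t - z).
(* The coefficients come from differentiating [ip (y t) (xd t)]. The weight [(alpha + 1) / 2]
   cancels the terms in [ip (x t - z) (xd t) / t^2]. What is left of the velocity is at most
   [3 / 2 * |xd t|^2 / t], which [3 / (2 * alpha)] times the dissipation [alpha / t * |xd t|^2]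
   absorbs. The logarithm spends the gain [- eps / t]. *)
pose P t := (alpha + 1) / 2 * ip (y t) (y t) + 3 / (2 * alpha) * f i (x t) + eps * ln t.
pose dP t := (alpha + 1) * ip (dy t) (y t) + 3 / (2 * alpha) * ip (g i (x t)) (xd t)
             + eps * t^-1.
(* Half the coefficient of [f i], so that the two terms together form a multiple of [W i]. *)
pose c := 3 / (4 * alpha).
have Dy t : t0 < t -> is_derive t 1 y (dy t).
  move=> tt0; have tn0 : t != 0 by rewrite gt_eqF // (lt_trans t00).
  have DV : is_derive t 1 (fun s : R => s^-1) (- t ^- 2 *: 1).
    exact: (is_deriveV tn0 (is_derive_id t 1)).
  have DB := is_deriveB (Dx t tt0) (is_derive_cst z t 1).
  have D := is_derive_scale DV DB.
  have -> : dy t = (- t ^- 2 * 1) *: (x t - z) + t^-1 *: (xd t - 0); last exact: D.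
  by rewrite /dy subr0 addrC mulr1 scaleNr exprVn.
have DP t : t0 < t -> is_derive t 1 P (dP t).
  move=> tt0; have D1 := is_derive_ip _ _ _ _ _ (Dy t tt0) (Dy t tt0).
  have t_gt0 : 0 < t := lt_trans t00 tt0.
  have D2 := is_derive1_ln t_gt0.
  have D := (is_deriveD (is_deriveD (is_deriveZ ((alpha + 1) / 2) D1)
       (is_deriveZ (3 / (2 * alpha)) (Dfx i t tt0))) (is_deriveZ eps D2)).
  have -> : dP t = (alpha + 1) / 2 * (ip (dy t) (y t) + ip (y t) (dy t)) +
      3 / (2 * alpha) * ip (g i (x t)) (xd t) + eps * t^-1; last exact: D.
  by rewrite /dP (ipC (y t)); congr (_ + _ + _); lra.
have Cdy t : t0 < t -> {for t, continuous dy}.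
  move=> tt0; have tn0 : t != 0 by rewrite gt_eqF // (lt_trans t00).
  have tV : s^-1 @[s --> t] --> t^-1 by apply: cvgV => //; exact: cvg_id.
  apply: cvgB.
    by apply: cvgZ; [exact: tV|exact: xd_continuous].
  apply: cvgZ; first exact: (cvgM tV tV).
  apply: cvgB; last exact: cvg_cst.
  exact: is_derive_continuous (Dx t tt0).
have CdP t : t0 < t -> {for t, continuous dP}.
  move=> tt0; have tn0 : t != 0 by rewrite gt_eqF // (lt_trans t00).
  have tV : s^-1 @[s --> t] --> t^-1 by apply: cvgV => //; exact: cvg_id.
  apply: cvgD; last by apply: cvgM; [exact: cvg_cst|exact: tV].
  apply: cvgD; apply: cvgM; try exact: cvg_cst.
    by apply: cvg_ip; [exact: Cdy|exact: is_derive_continuous (Dy t tt0)].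
  exact: gx_continuous.
pose Phi t := ip (y t) (xd t) + c * ip (xd t) (xd t) + P t.
(* The start must be strictly after [t0], where [x] has two-sided derivatives and [ln] is
   differentiable. *)
pose a := t0 + 1.
have Phi_le t : a <= t -> Phi t <= Phi a.
  move=> at_; have at0 : t0 < a by rewrite /a; lra.
  apply: (energy_nonincreasing xd y xdd dy P dP N c) => //.
  - by apply: (@abs_cont_on_subset _ _ _ t0); [exact: ltW|apply: xdAC; lra].
  - move=> r ar rt; have rt0 : t0 < r by lra.
    split; [exact: xd_continuous|exact: Cdy|exact: CdP].
  - move=> r ar rt; have rt0 : t0 < r by lra.
    by split; [exact: Dy|exact: DP].
  - move=> r ar rt rN; have rt0 : t0 < r by lra.
    have [Dxd [w [[[v Cv vw] _] wE]]] := sol r rt0 rN; split => //.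
    have r0 : 0 < r := lt_trans t00 rt0.
    have T0 : 0 < r^-1 by rewrite invr_gt0.
    have duE : xdd r = - (alpha * r^-1) *: xd r - v.
      by apply/eqP; rewrite scaleNr -opprD -addr_eq0 addrC -addrA vw wE.
    (* For every [j], [f j z + eps <= l j <= W j r]; subtract [f j (x r)]. *)
    have desc : ip v (z - x r) <= - eps + 2^-1 * ip (xd r) (xd r).
      apply: (conv_grad_descent _ f g (x r)) => // j.
      have := epsP j; have := lW j r rt0; rewrite /W ipxx; lra.
    have pow : (3 / (2 * alpha)) * ip (xd r) (g i (x r) + xdd r)
             <= - (3 / 2 * r^-1 * ip (xd r) (xd r)).
      have := power i r rt0 rN.
      rewrite -(ler_pM2l (_ : 0 < 3 / (2 * alpha))); last by rewrite divr_gt0 //; lra.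
      move=> /le_trans; apply; rewrite le_eqVlt; apply/orP; left; apply/eqP.
      by field; rewrite !gt_eqF.
    have Tdesc := ler_wpM2l (ltW T0) desc.
    (* After all cancellations the derivative is at most minus this quantity: the goal is the sum of
       [pow], [Tdesc] and [X0]. *)
    have X0 : 0 <= (alpha + 1) * r^-1 ^+ 3 * ip (x r - z) (x r - z).
      by rewrite ipxx !mulr_ge0 ?sqr_ge0 ?exprn_ge0 //; lra.
    have yduE : ip (y r) (xdd r) = - (alpha * r^-1 ^+ 2) * ip (x r - z) (xd r)
                    + r^-1 * ip v (z - x r).
      by rewrite duE /y ipZl ipBr ipZr (ipC _ v) -(opprB z (x r)) !ipNr !ipNl; ring.
    move: pow; rewrite ipDr yduE /dP /dy /y.
    move: (x r - z) X0 => X X0; rewrite !ipBl !ipZl !ipZr.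
    rewrite (ipC (xd r) (g i (x r))) (ipC (xd r) X).
    have cE : c * (2 * ip (xd r) (xdd r)) = 3 / (2 * alpha) * ip (xd r) (xdd r).
      by rewrite /c; field; rewrite gt_eqF.
    rewrite cE; move: X0 Tdesc.
    set p := 3 / (2 * alpha); set T := r^-1; lra.
(* Completing the square bounds [ip (y t) (xd t)] plus half of [|y t|^2] below by [- |xd t|^2 / 2],
   and [|xd t|^2 / 2 = W i t - f i (x t)] is at most [W i a - b]. *)
pose K := Phi a - 3 / (2 * alpha) * b + (W i a - b).
have lnK t : a <= t -> eps * ln t <= K.
  move=> at_; have at0 : t0 < a by rewrite /a; lra.
  have := Phi_le t at_; have := mechanical_energy_nonincreasing i a t at0 at_.
  rewrite /Phi /P /W -!ipxx.
  have := sqr_ge0 `|y t + xd t|; rewrite -ipxx ipDl !ipDr (ipC (xd t) (y t)).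
  have u0 : 0 <= c * ip (xd t) (xd t).
    by rewrite ipxx mulr_ge0 ?sqr_ge0 // divr_ge0 //; lra.
  have y0 : 0 <= alpha * ip (y t) (y t) by rewrite ipxx mulr_ge0 ?sqr_ge0 //; lra.
  have : 3 / (2 * alpha) * b <= 3 / (2 * alpha) * f i (x t).
    by rewrite ler_wpM2l // divr_ge0 //; lra.
  have := fb (x t).
  move: u0 y0; rewrite /K /Phi /P /W -!ipxx; lra.
(* At this time [eps * ln t] is at least [K + 1], against [lnK]. *)
have : a <= Num.max a (expR ((K + 1) / eps)) by rewrite le_max lexx.
move/lnK; apply/negP; rewrite -ltNge mulrC -ltr_pdivrMr //.
apply: (@lt_le_trans _ _ ((K + 1) / eps)); first by rewrite ltr_pM2r ?invr_gt0 //; lra.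
rewrite -[X in X <= _]expRK ler_ln ?posrE ?expR_gt0 //; first by rewrite le_max lexx orbT.
by rewrite lt_max expR_gt0 orbT.
Qed.

Lemma energy_and_objective_cvg (b : 'I_m -> R) :
  (forall i y, b i <= f i y) -> forall i, exists l : R,
    (f i (x t) @[t --> +oo] --> l) /\ (W i t @[t --> +oo] --> l).
Proof.
move=> fb i.
have /choice[l lP] j : exists l : R, W j t @[t --> +oo] --> l /\
    forall t, t0 < t -> l <= W j t.
  have [] := @nonincreasing_cvgy R (W j) t0 (b j).
  - exact: mechanical_energy_nonincreasing.
  - by move=> t; have := fb j (x t); have := sqr_ge0 `|xd t|; rewrite /W; lra.
  by move=> l; exists l.
(* The index supplied by the previous lemma at [z = x t] varies with [t]; summing all the
   nonnegative gaps gives one bound that still tends to 0. *)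
have kin_le t : t0 < t -> 2^-1 * `|xd t| ^+ 2 <= \sum_j (W j t - l j).
  move=> tt0.
  have /existsNP[j /negP] : ~ (forall j, f j (x t) < l j).
    apply: (energy_limits_not_dominated i l (b i)) => //.
    by move=> k s st0; apply: (lP k).2.
  rewrite -leNgt => lj; apply: (@le_trans _ _ (W j t - l j)); first by rewrite /W; lra.
  rewrite (bigD1 j) //= lerDl; apply: sumr_ge0 => k _.
  by rewrite subr_ge0; exact: (lP k).2.
have sum0 : \sum_j (W j t - l j) @[t --> +oo] --> (0 : R).
  have /= := @cvg_big R 'I_m +%R 0 xpredT (@add_continuous _) R (nbhs +oo%R)
    (index_enum _) (fun j t => W j t - l j) (fun j => l j - l j) _.
  rewrite [\sum_(j < m) (l j - l j)]big1; last by move=> j _; rewrite subrr.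
  apply => j _.
  by apply: cvgB; [exact: (lP j).1|exact: cvg_cst].
have kin0 : 2^-1 * `|xd t| ^+ 2 @[t --> +oo] --> (0 : R).
  apply: (squeeze_cvgr (f := cst 0) (h := fun t => \sum_j (W j t - l j))) => //;
    last exact: cvg_cst.
  near=> t.
  rewrite mulr_ge0 ?sqr_ge0 //=; apply: kin_le; near: t.
  by apply: nbhs_pinfty_gt; rewrite num_real.
exists (l i); split; last by case: (lP i).
have -> : (fun t => f i (x t)) = (fun t => W i t - 2^-1 * `|xd t| ^+ 2).
  by apply/funext => t; rewrite /W; ring.
by have := cvgB (lP i).1 kin0; rewrite subr0; apply.
Unshelve. all: by end_near. Qed.

End Hilbert.

Theorem theorem4p9 (R : realType) (H : completeNormedModType R)
    (ip : H -> H -> R) (m : nat) (f : 'I_m -> H -> R) (g : 'I_m -> H -> H)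
    (alpha t0 : R) (x0 : H) (x xd xdd : R -> H) :
  is_inner_product ip ->
  (forall i, convex_fun (f i)) ->
  (forall i, C1_with_gradient ip (f i) (g i)) ->
  0 < alpha -> 0 < t0 ->
  (* x is a solution of the Cauchy problem *)
  C1_from t0 x xd ->
  (forall T, t0 <= T -> abs_cont_on xd t0 T) ->
  (exists N : set R, (@lebesgue_measure R).-negligible N /\
     forall t, t0 < t -> ~ N t ->
       is_derive t 1 xd (xdd t) /\
       exists w, is_proj (translate (conv_grad g (x t)) (xdd t)) 0 w /\
                 (alpha / t) *: xd t + w = 0) ->
  x t0 = x0 -> xd t0 = 0 ->
  (* hypotheses on the objectives *)
  (forall i, exists b : R, forall y, b <= f i y) ->
  pareto_assumption f ->
  forall i, exists l : R,
    (f i (x t) @[t --> +oo] --> l) /\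
    (f i (x t) + 2%:R^-1 * `|xd t| ^+ 2 @[t --> +oo] --> l).
Proof.
move=> ipP cf Cf alpha0 t00 xC1 xdAC [N [N0 sol]] _ _ fb _ i.
have [b bP] := choice fb.
exact: (energy_and_objective_cvg _ _ _ ipP _ f g alpha t0 x xd xdd N cf Cf alpha0 t00
  xC1 xdAC N0 sol b bP i).
Qed.
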